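(* Let the Hermitian matrix $A \in \mathbb{C}^{N \times N}$ be $3$-PMP, let $\pi = \pi^{\{1\}}(A) = \{ I_1, \dots, I_m \}$, and let $\pi' = \{ I'_1, \dots, I'_{m'} \}$ be any partition of $\{1, \dots, N\}$ refined by $\pi$ (i.e., each block of $\pi$ is contained in a block of $\pi'$). The following subspaces of $\mathbb{C}^N$ are equal. (1) The simultaneous kernel of $A^{\circ 0} = \mathbf{1}_N$, $A$, $\dots$, $A^{\circ (N-1)}$, i.e. $\bigcap_{n=0}^{N-1} \ker A^{\circ n}$. (2) The simultaneous kernel of $A^{\circ n}$ for all $n \geq 0$, i.e. $\bigcap_{n \geq 0} \ker A^{\circ n}$. (3) The simultaneous kernel of the block-diagonal matrices $\bigoplus_{j=1}^{m'} A^{\circ n}_{I'_j \times I'_j}$ for all $n \geq 0$. (4) The kernel of $J_\pi := \bigoplus_{j=1}^m \mathbf{1}_{I_j}$. However, this equality of kernels need not hold for matrices that are not $3$-PMP: there exist a positive integer $N$ and a Hermitian matrix $A \in \mathbb{C}^{N \times N}$ which is not $3$-PMP for which the corresponding spaces are not all equal.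
   Context: A Hermitian matrix in $\mathbb{C}^{N \times N}$ is called $3$-PMP (principal minor positive) if all its principal minors of size at most $3$ are non-negative. For $A = (a_{ij})$, the Hadamard powers are $A^{\circ n} := (a_{ij}^n)$ for $n \geq 1$, and $A^{\circ 0} := \mathbf{1}_N$, the $N \times N$ matrix with all entries equal to $1$. For any Hermitian $A \in \mathbb{C}^{N \times N}$, $\pi^{\{1\}}(A)$ denotes the (unique, up to relabelling) coarsest partition $\{ I_1, \dots, I_m \}$ of $\{1, \dots, N\}$ such that, for all $i, j \in \{1, \dots, m\}$, the block $A_{I_i \times I_j}$ (rows indexed by $I_i$, columns by $I_j$) is constant, i.e. has all its entries equal. For a partition $\{K_1, \dots, K_r\}$ of $\{1, \dots, N\}$, the block-diagonal matrix $\bigoplus_{j=1}^r A^{\circ n}_{K_j \times K_j}$ is the $N \times N$ matrix whose $(p,q)$ entry is the $(p,q)$ entry of $A^{\circ n}$ if $p$ and $q$ lie in the same block $K_j$, and $0$ otherwise. Similarly, $\bigoplus_{j=1}^m \mathbf{1}_{I_j}$ is the $N \times N$ matrix whose $(p,q)$ entry is $1$ if $p$ and $q$ lie in the same block $I_j$, and $0$ otherwise. *)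

(* Defs.v *)
From mathcomp Require Import all_boot all_order all_algebra.
From mathcomp Require Import sesquilinear.

Set Implicit Arguments.
Unset Strict Implicit.
Unset Printing Implicit Defensive.

Import Order.TTheory GRing.Theory Num.Theory.

Local Open Scope ring_scope.

Definition principal_minor (C : comNzRingType) (N : nat) (A : 'M[C]_N)
    (S : {set 'I_N}) : C :=
  \det (mxsub (fun i : 'I_#|S| => enum_val i) (fun j : 'I_#|S| => enum_val j) A).

(* In the partial order of a numClosedFieldType, 0 <= z means that z is real
   and nonnegative. *)
Definition three_PMP (C : numClosedFieldType) (N : nat) (A : 'M[C]_N) : Prop :=
  A \is hermsymmx /\
  forall S : {set 'I_N}, (#|S| <= 3)%N -> 0 <= principal_minor A S.

(* Since x ^+ 0 = 1 for every x, including x = 0, the zeroth Hadamard power is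
   the all-ones matrix. *)
Definition hadamard_pow (C : nzRingType) (N : nat) (A : 'M[C]_N) (n : nat) :
    'M[C]_N :=
  map_mx (fun x => x ^+ n) A.

Definition refines (T : finType) (P Q : {set {set T}}) : Prop :=
  forall B : {set T}, B \in P -> exists2 D : {set T}, D \in Q & B \subset D.

Definition constant_block (C : Type) (N : nat) (A : 'M[C]_N)
    (I J : {set 'I_N}) : Prop :=
  forall p p' q q' : 'I_N, p \in I -> p' \in I -> q \in J -> q' \in J ->
    A p q = A p' q'.

Definition block_constant_partition (C : Type) (N : nat) (A : 'M[C]_N)
    (P : {set {set 'I_N}}) : Prop :=
  partition P [set: 'I_N] /\
  forall I J : {set 'I_N}, I \in P -> J \in P -> constant_block A I J.

(* "pi is the coarsest partition": it is block-constant, and every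
   block-constant partition refines it. *)
Definition is_isogenic_partition (C : Type) (N : nat) (A : 'M[C]_N)
    (pi : {set {set 'I_N}}) : Prop :=
  block_constant_partition A pi /\
  forall P : {set {set 'I_N}}, block_constant_partition A P -> refines P pi.

Definition block_diag (C : nzRingType) (N : nat) (P : {set {set 'I_N}})
    (A : 'M[C]_N) : 'M[C]_N :=
  \matrix_(p < N, q < N) (if q \in pblock P p then A p q else 0).

Lemma refines_anti (T : finType) (P Q : {set {set T}}) :
  partition P [set: T] -> partition Q [set: T] ->
  refines P Q -> refines Q P -> P = Q.
Proof.
have sub P1 Q1 : partition P1 [set: T] -> refines P1 Q1 -> refines Q1 P1 ->
    P1 \subset Q1.
  move=> /and3P[_ /trivIsetP tP P0] PQ QP; apply/subsetP => B BP.
  have [D DQ BD] := PQ B BP.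
  have [E EP DE] := QP D DQ.
  have [EB|/tP dis] := eqVneq B E.
    suff -> : B = D by [].
    by apply/eqP; rewrite eqEsubset BD EB.
  have : B = set0 :> {set T}.
    apply/eqP; rewrite -subset0; apply/subsetP => x xB.
    have xE : x \in E by apply: (subsetP DE); apply: (subsetP BD).
    by have := dis BP EP => /disjointFr/(_ xB); rewrite xE.
  by move=> B0; move: P0; rewrite -B0 BP.
move=> pP pQ PQ QP; apply/eqP; rewrite eqEsubset.
by rewrite (sub _ _ pP PQ QP) (sub _ _ pQ QP PQ).
Qed.

Lemma isogenic_partition_unique (C : Type) (N : nat) (A : 'M[C]_N)
    (pi1 pi2 : {set {set 'I_N}}) :
  is_isogenic_partition A pi1 -> is_isogenic_partition A pi2 -> pi1 = pi2.
Proof.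
move=> [b1 m1] [b2 m2]; apply: refines_anti; first by case: b1.
- by case: b2.
- exact: m2.
- exact: m1.
Qed.

Lemma isogenic_partition_exists (C : eqType) (N : nat) (A : 'M[C]_N) :
  exists pi : {set {set 'I_N}}, is_isogenic_partition A pi.
Proof.
pose R (p q : 'I_N) := [forall k, (A p k == A q k) && (A k p == A k q)].
have RP p q : reflect (forall k, A p k = A q k /\ A k p = A k q) (R p q).
  apply: (iffP forallP) => h k; first by have /andP[/eqP -> /eqP ->] := h k.
  by have [-> ->] := h k; rewrite !eqxx.
have eqR : {in [set: 'I_N] & &, equivalence_rel R}.
  move=> x y z _ _ _; split; first by apply/RP.
  move=> /RP xy; apply/RP/RP => h k.
    by have [a b] := xy k; have [c d] := h k; rewrite -a -b.
  by have [a b] := xy k; have [c d] := h k; rewrite a b.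
pose pi := equivalence_partition R [set: 'I_N].
have ppi : partition pi [set: 'I_N] := equivalence_partitionP eqR.
have tpi : trivIset pi by case/and3P: ppi.
have inR I p p' : I \in pi -> p \in I -> p' \in I -> R p p'.
  move=> Ipi pI p'I.
  rewrite -(pblock_equivalence_partition eqR) ?inE//.
  by rewrite -/pi (def_pblock tpi Ipi pI).
exists pi; split; first split => //.
  move=> I J Ipi Jpi p p' q q' pI p'I qJ q'J.
  have /RP/(_ q)[-> _] := inR _ _ _ Ipi pI p'I.
  by have /RP/(_ p')[_ ->] := inR _ _ _ Jpi qJ q'J.
move=> P [pP cP] B BP.
have /and3P[/eqP cov tP P0] := pP.
have [x xB] : exists x, x \in B.
  by apply/set0Pn; apply: contraNneq P0 => <-.
have inP k : exists2 D, D \in P & k \in D.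
  by apply/bigcupP; rewrite -/(cover P) cov inE.
exists (pblock pi x).
  by apply: pblock_mem; case/and3P: ppi => /eqP ->; rewrite inE.
apply/subsetP => y yB.
rewrite pblock_equivalence_partition ?inE//; apply/RP => k.
have [D DP kD] := inP k.
by split; [exact: (cP B D BP DP)|exact: (cP D B DP BP)].
Qed.

(* Imported only here because classical_sets shadows finset's partition,
   pblock, cover, trivIset, etc. *)
From mathcomp Require Import classical_sets.

Local Open Scope classical_set_scope.

(* The right kernel, a set of column vectors; mathcomp's kermx is the left
   kernel, acting on row vectors. *)
Definition rker (C : nzRingType) (N : nat) (M : 'M[C]_N) : set 'cV[C]_N :=
  [set v : 'cV[C]_N | M *m v = 0].

Definition ker_first_powers (C : nzRingType) (N : nat) (A : 'M[C]_N) :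
    set 'cV[C]_N :=
  \bigcap_(n in [set n : nat | (n < N)%N]) rker (hadamard_pow A n).

Definition ker_all_powers (C : nzRingType) (N : nat) (A : 'M[C]_N) :
    set 'cV[C]_N :=
  \bigcap_(n in [set: nat]) rker (hadamard_pow A n).

Definition ker_block_powers (C : nzRingType) (N : nat) (A : 'M[C]_N)
    (pi' : {set {set 'I_N}}) : set 'cV[C]_N :=
  \bigcap_(n in [set: nat]) rker (block_diag pi' (hadamard_pow A n)).

Definition ker_J (C : nzRingType) (N : nat) (pi : {set {set 'I_N}}) :
    set 'cV[C]_N :=
  rker (block_diag pi (const_mx 1)).
Arguments ker_J C {N} pi.

Definition kernels_agree (C : nzRingType) (N : nat) (A : 'M[C]_N)
    (pi pi' : {set {set 'I_N}}) : Prop :=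
  [/\ ker_first_powers A = ker_all_powers A,
      ker_all_powers A = ker_block_powers A pi' &
      ker_block_powers A pi' = ker_J C pi].

(* Main.v *)
Require Import Defs.
From mathcomp Require Import all_boot all_order all_algebra.
From mathcomp Require Import perm sesquilinear ring.
From mathcomp Require Import boolp classical_sets reals.
From mathcomp.real_closed Require Import complex.

Set Implicit Arguments.
Unset Strict Implicit.
Unset Printing Implicit Defensive.

Import Order.TTheory GRing.Theory Num.Theory.

Local Open Scope ring_scope.

(** Write [v] for a column vector and [S p] for the sum of its entries over the
    block of [pi] containing [p]. The kernel of [J_pi] is the set of those [v]
    with [S p = 0] for all [p]. The rows of [A] are constant along the blocks of
    [pi], so such a [v] is killed by every Hadamard power of [A], and by the
    block-diagonal truncations for any coarser [pi'] ([ker_J_sub_block]).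

    The converse is [block_sub_ker_J]; it only uses the first [N] powers, and
    treats all [pi'] at once, the case of the full powers being [pi' = {setT}].
    Row [p] of the equations consists of power sums in the at most [N] values
    [A p q], weighted by [v]. By a Vandermonde argument
    ([power_sums_level_set]), [v] sums to zero over each level set of
    [q |-> A p q] inside the [pi']-block of [p]. Take the level of the diagonal
    entry [A p p]. If [A p q = A p p], the [2 x 2] minor on [{p, q}] gives
    [A p p <= A q q] ([three_PMP_diag_le]), and in case of equality the [3 x 3]
    minors force rows [p] and [q] to coincide ([three_PMP_diag_eq_rows]), that
    is, [q] lies in the [pi]-block of [p]. So the level set is that block together
    with other blocks of strictly larger diagonal entry, and [S p = 0] follows by
    induction, from the largest diagonal entries downwards.

    For the last assertion, a [4 x 4] symmetric matrix with entries 0 and 1 and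
    pairwise distinct rows has all its Hadamard powers annihilated by
    [(1, -1, 1, -1)]; that it is not 3-PMP then follows from the first part. *)

(** * Principal minors of order at most three *)

Lemma det_mx22 (R : comNzRingType) (M : 'M[R]_2) :
  \det M = M 0 0 * M 1 1 - M 0 1 * M 1 0.
Proof.
rewrite (expand_det_row _ 0) !big_ord_recl big_ord0 /cofactor !det_mx11 !mxE /=.
have -> : lift 0 0 = 1 :> 'I_2 by apply: val_inj.
have -> : lift 1 0 = 0 :> 'I_2 by apply: val_inj.
rewrite addn0 addn1 expr0 expr1; ring.
Qed.

Lemma det_mx33 (R : comNzRingType) (M : 'M[R]_3) :
  \det M = M 0 0 * (M 1 1 * M 2%:R 2%:R - M 1 2%:R * M 2%:R 1)
         - M 0 1 * (M 1 0 * M 2%:R 2%:R - M 1 2%:R * M 2%:R 0)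
         + M 0 2%:R * (M 1 0 * M 2%:R 1 - M 1 1 * M 2%:R 0).
Proof.
rewrite (expand_det_row _ 0) !big_ord_recl big_ord0 /cofactor !det_mx22 !mxE /=.
rewrite /bump /= !addnE /=.
have l00 : lift 0 0 = 1 :> 'I_3 by apply: val_inj.
have l01 : lift 0 1 = 2%:R :> 'I_3 by apply: val_inj.
have l10 : lift 1 0 = 0 :> 'I_3 by apply: val_inj.
have l11 : lift 1 1 = 2%:R :> 'I_3 by apply: val_inj.
have l20 : lift 2%:R 0 = 0 :> 'I_3 by apply: val_inj.
have l21 : lift 2%:R 1 = 1 :> 'I_3 by apply: val_inj.
have l0' : lift 0 0 = 1 :> 'I_2 by apply: val_inj.
rewrite ?(l0', l00, l01, l10, l11, l20, l21) /=.
rewrite expr0 expr1 -signr_odd /= expr0; ring.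
Qed.

(** Two injective enumerations of one index set differ by a permutation, which
    acts on rows and on columns at once, so that its sign occurs squared. *)
Lemma det_mxsub_inj (R : comNzRingType) (N m k : nat) (A : 'M[R]_N)
    (f : 'I_m -> 'I_N) (g : 'I_k -> 'I_N) :
  m = k -> injective f -> (forall u, f u \in codom g) ->
  \det (mxsub f f A) = \det (mxsub g g A).
Proof.
move=> mk; case: _ / mk g => g injf fg.
pose h u := iinv (fg u).
have gh u : g (h u) = f u by exact: f_iinv.
have injh : injective h by move=> u w e; apply: injf; rewrite -!gh e.
have -> : mxsub f f A =
    row_perm (perm injh) (col_perm (perm injh) (mxsub g g A)).
  by apply/matrixP => u w; rewrite !mxE !permE !gh.
rewrite row_permE col_permE !det_mulmx !det_perm odd_permV mulrCA -expr2.
by rewrite sqrr_sign mulr1.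
Qed.

(** Principal minors are defined through the enumeration of a set; this form
    allows the indices to be listed in any order. *)
Lemma three_PMP_minor_ge0 (C : numClosedFieldType) (N : nat) (A : 'M[C]_N)
    (s : seq 'I_N) (x0 : 'I_N) :
  three_PMP A -> uniq s -> (size s <= 3)%N ->
  0 <= \det (\matrix_(u < size s, w < size s) A (nth x0 s u) (nth x0 s w)).
Proof.
move=> [_ pA] us s3; pose f (u : 'I_(size s)) := nth x0 s u.
rewrite -[X in \det X]/(mxsub f f A).
have cs : #|[set x in s]| = size s by rewrite cardsE; apply/card_uniqP.
rewrite (@det_mxsub_inj _ _ _ _ _ _ (@enum_val _ (mem [set x in s]))).
- by apply: pA; rewrite cs.
- by rewrite cs.
- move=> u w /eqP; rewrite nth_uniq// => /eqP; exact: val_inj.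
move=> u; have fs : f u \in [set x in s] by rewrite inE mem_nth.
by rewrite -(enum_rankK_in fs fs) codom_f.
Qed.

(** * Entries of a 3-PMP matrix *)

Lemma hermsymmx_conj (C : numClosedFieldType) (N : nat) (A : 'M[C]_N) :
  A \is hermsymmx -> forall p q, A q p = (A p q)^*.
Proof.
by move=> /is_hermitianmxP hA p q; rewrite {1}hA !mxE expr0 mul1r.
Qed.

Lemma three_PMP_diag_ge0 (C : numClosedFieldType) (N : nat) (A : 'M[C]_N) p :
  three_PMP A -> 0 <= A p p.
Proof.
move=> hA; have := @three_PMP_minor_ge0 _ _ A [:: p] p hA isT isT.
by rewrite /= det_mx11 !mxE.
Qed.

Lemma three_PMP_minor2 (C : numClosedFieldType) (N : nat) (A : 'M[C]_N) p q :
  three_PMP A -> `|A p q| ^+ 2 <= A p p * A q q.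
Proof.
move=> hA; have hermA := hermsymmx_conj hA.1.
have [<-|pq] := eqVneq p q; first by rewrite normCK -hermA.
have := @three_PMP_minor_ge0 _ _ A [:: p; q] p hA.
rewrite /= inE pq => /(_ isT isT).
by rewrite det_mx22 !mxE /= (hermA p q) -normCK subr_ge0.
Qed.

(** If [A p q = A p p =: d], the [2 x 2] minor gives [d ^+ 2 <= d * A q q].
    Along a coincidence with the diagonal entry, the diagonal can only grow. *)
Lemma three_PMP_diag_le (C : numClosedFieldType) (N : nat) (A : 'M[C]_N) p q :
  three_PMP A -> A p q = A p p -> A p p <= A q q.
Proof.
move=> hA e; have := three_PMP_minor2 p q hA.
have p0 := three_PMP_diag_ge0 p hA.
rewrite e ger0_norm// expr2.
move: p0; rewrite le_eqVlt => /predU1P[<- _|p0].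
  exact: three_PMP_diag_ge0.
by rewrite ler_pM2l.
Qed.

(** If the block on [{p, q}] is constant, equal to [d], then the minor on
    [{p, q, k}] is [- d * `|A p k - A q k| ^+ 2]; it can only be nonnegative if
    [A p k = A q k], provided that [d > 0]. For [d = 0] the [2 x 2] minors make
    both rows zero. *)
Lemma three_PMP_diag_eq_rows (C : numClosedFieldType) (N : nat) (A : 'M[C]_N)
    p q :
  three_PMP A -> A p q = A p p -> A q q = A p p -> forall k, A p k = A q k.
Proof.
move=> hA e e' k; have hermA := hermsymmx_conj hA.1.
have p0 := three_PMP_diag_ge0 p hA.
have qp : A q p = A p p by rewrite (hermA p q) e -hermA.
have [->|kp] := eqVneq k p; first by rewrite qp.
have [->|kq] := eqVneq k q; first by rewrite e e'.
have [<- //|pq] := eqVneq p q.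
have [d0|dn0] := eqVneq (A p p) 0.
  have z r : A r r = 0 -> A r k = 0.
    move=> r0; have := three_PMP_minor2 r k hA; rewrite r0 mul0r => h.
    apply/eqP; rewrite -normr_eq0 -sqrf_eq0.
    by rewrite eq_le h exprn_ge0.
  by rewrite !z ?e'.
have {dn0}p0 : 0 < A p p by rewrite lt_neqAle eq_sym dn0.
have := @three_PMP_minor_ge0 _ _ A [:: p; q; k] p hA.
rewrite /= !inE [p == k]eq_sym [q == k]eq_sym.
rewrite (negbTE pq) (negbTE kp) (negbTE kq).
move=> /(_ isT isT).
rewrite det_mx33 !mxE /= e e' qp (hermA p k) (hermA q k).
set d := A p p; set x := A p k; set y := A q k; set z := A k k.
have -> : d * (d * z - y * y^*) - d * (d * z - y * x^*)
    + x * (d * y^* - d * x^*) = - (d * ((x - y) * (x^* - y^*))) by ring.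
rewrite -rmorphB -normCK oppr_ge0 pmulr_rle0// => h.
apply/eqP; rewrite -subr_eq0 -normr_eq0 -sqrf_eq0.
by rewrite eq_le h exprn_ge0.
Qed.

(** * Sums over level sets and over blocks *)

(** A Vandermonde argument: the hypothesis says that the functional
    [P |-> \sum_i P.[a i] * v i] vanishes on polynomials of size at most [#|I|].
    The product of the ['X - x%:P] over the values [x] of [a] other than [c] has
    such a size, and separates the level set of [c] from the others. *)
Lemma power_sums_level_set (F : idomainType) (I : finType) (a v : I -> F) :
  (forall n, (n < #|I|)%N -> \sum_i a i ^+ n * v i = 0) ->
  forall c, \sum_(i | a i == c) v i = 0.
Proof.
move=> h c.
have [cI|cI] := boolP (c \in codom a); last first.
  by rewrite big1// => i /eqP ai; rewrite -ai codom_f in cI.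
pose s := rem c (undup (codom a)).
pose P : {poly F} := \prod_(x <- s) ('X - x%:P).
have sP : (size P <= #|I|)%N.
  rewrite size_prod_XsubC size_rem ?mem_undup// prednK; last first.
    by rewrite -has_predT; apply/hasP; exists c; rewrite ?mem_undup.
  by rewrite -(size_codom a) size_undup.
have Pc : P.[c] != 0.
  rewrite -[_ == 0]/(root P c) root_prod_XsubC mem_rem_uniq ?undup_uniq//.
  by rewrite !inE eqxx.
have Pa i : a i != c -> P.[a i] = 0.
  move=> ai; apply/rootP; rewrite root_prod_XsubC mem_rem_uniq ?undup_uniq//.
  by rewrite !inE ai mem_undup codom_f.
have S0 : \sum_i P.[a i] * v i = 0.
  under eq_bigr do rewrite (horner_coef_wide _ sP) mulr_suml.
  rewrite exchange_big big1//= => n _.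
  under eq_bigr do rewrite -mulrA.
  by rewrite -mulr_sumr h ?mulr0.
apply: (mulfI Pc); rewrite mulr0 mulr_sumr -[RHS]S0.
rewrite [RHS](bigID (fun i => a i == c))/= [X in _ + X]big1 ?addr0.
  by apply: eq_bigr => i /eqP ->.
by move=> i /Pa ->; rewrite mul0r.
Qed.

(** The block sums of [v] are only required to vanish where [f] is nonzero, so
    that the lemma can be used in an induction that has so far reached only some
    of the blocks. *)
Lemma sum_block_const (F : pzRingType) (T : finType) (P : {set {set T}})
    (f v : T -> F) :
  finset.partition P [set: T] ->
  (forall p q, q \in finset.pblock P p -> f q = f p) ->
  (forall p, f p != 0 -> \sum_(q in finset.pblock P p) v q = 0) ->
  \sum_q f q * v q = 0.
Proof.
move=> /and3P[/eqP cP tP P0] fc h.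
have -> : \sum_q f q * v q = \sum_(q in finset.cover P) f q * v q.
  by rewrite cP; apply: eq_bigl => q; rewrite inE.
rewrite big_trivIset// big1// => B BP.
have /finset.set0Pn[p pB] : B != finset.set0 by apply: contraNneq P0 => <-.
have EB := def_pblock tP BP pB.
under eq_bigr => q qB do rewrite (fc p) ?EB//.
by have [->|fp] := eqVneq (f p) 0; rewrite -mulr_sumr ?mul0r// -EB h ?mulr0.
Qed.

(** * The isogenic partition *)

(** The coarsest block-constant partition consists of the classes of equal rows.
    For a Hermitian matrix equality of rows entails equality of the columns, so
    that those classes do form a block-constant partition. *)
Lemma isogenic_pblockP (C : numClosedFieldType) (N : nat) (A : 'M[C]_N)
    (pi : {set {set 'I_N}}) :
  A \is hermsymmx -> is_isogenic_partition A pi ->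
  forall p q, reflect (forall k, A p k = A q k) (q \in finset.pblock pi p).
Proof.
move=> /hermsymmx_conj hermA [[ppi cpi] maxpi] p q.
have /and3P[/eqP cov tpi _] := ppi.
have inpi k : finset.pblock pi k \in pi by rewrite pblock_mem// cov inE.
have mempb k : k \in finset.pblock pi k by rewrite mem_pblock cov inE.
apply: (iffP idP) => [qp k|rows]; first exact: (cpi _ _ (inpi p) (inpi k)).
pose R (p q : 'I_N) := [forall k, A p k == A q k].
have RP x y : reflect (forall k, A x k = A y k) (R x y).
  by apply: (iffP forallP) => h k; apply/eqP; apply: h.
have eqR : {in [set: 'I_N] & &, equivalence_rel R}.
  move=> x y z _ _ _; split; first by apply/RP.
  by move=> /RP xy; apply/RP/RP => h k; rewrite ?xy// -xy.
have pR := equivalence_partitionP eqR.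
have /and3P[/eqP covR tR _] := pR.
set P := equivalence_partition R _ in pR covR tR.
have inR I x y : I \in P -> x \in I -> y \in I -> forall k, A x k = A y k.
  move=> IP xI yI; apply/RP.
  by rewrite -(pblock_equivalence_partition eqR) ?inE// (def_pblock tR IP xI).
have constP : block_constant_partition A P.
  split => // I J IP JP x x' y y' xI x'I yJ y'J.
  by rewrite (inR I x x')// hermA (inR J y y')// -hermA.
have [|D Dpi BD] := maxpi P constP (finset.pblock P p).
  by rewrite pblock_mem// covR inE.
rewrite (def_pblock tpi Dpi); apply: (fintype.subsetP BD).
  by rewrite pblock_equivalence_partition ?inE//; apply/RP.
by rewrite mem_pblock covR inE.
Qed.

Lemma refines_pblock (T : finType) (P Q : {set {set T}}) :
  finset.partition P [set: T] -> finset.partition Q [set: T] -> refines P Q ->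
  forall p q r, r \in finset.pblock P q ->
    (r \in finset.pblock Q p) = (q \in finset.pblock Q p).
Proof.
move=> /and3P[/eqP cP tP P0] /and3P[/eqP cQ tQ Q0] PQ p q r rq.
have [|D DQ sD] := PQ (finset.pblock P q); first by rewrite pblock_mem// cP inE.
have rD := fintype.subsetP sD r rq.
have qD : q \in D by apply: (fintype.subsetP sD); rewrite mem_pblock cP inE.
have pb x : x \in finset.cover Q by rewrite cQ inE.
by rewrite -!eq_pblock// (def_pblock tQ DQ rD) (def_pblock tQ DQ qD).
Qed.

(** * Kernels as vanishing sums *)

Lemma block_diag_mulE (C : nzRingType) (N : nat) (P : {set {set 'I_N}})
    (A : 'M[C]_N) (v : 'cV[C]_N) p :
  (block_diag P A *m v) p 0 = \sum_(q in finset.pblock P p) A p q * v q 0.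
Proof.
rewrite mxE [RHS]big_mkcond; apply: eq_bigr => q _; rewrite mxE.
by case: ifP; rewrite ?mul0r.
Qed.

Lemma ker_JP (C : nzRingType) (N : nat) (P : {set {set 'I_N}}) (v : 'cV[C]_N) :
  ker_J C P v <-> forall p, \sum_(q in finset.pblock P p) v q 0 = 0.
Proof.
have E p : (block_diag P (const_mx 1) *m v) p 0
    = \sum_(q in finset.pblock P p) v q 0.
  by rewrite block_diag_mulE; apply: eq_bigr => q _; rewrite mxE mul1r.
split => [/matrixP h p|h]; first by rewrite -E h mxE.
by apply/matrixP => p j; rewrite ord1 E h mxE.
Qed.

Lemma rker_block_hadamardP (C : nzRingType) (N : nat) (P : {set {set 'I_N}})
    (A : 'M[C]_N) n (v : 'cV[C]_N) :
  rker (block_diag P (hadamard_pow A n)) v <->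
  forall p, \sum_(q in finset.pblock P p) A p q ^+ n * v q 0 = 0.
Proof.
have E p : (block_diag P (hadamard_pow A n) *m v) p 0
    = \sum_(q in finset.pblock P p) A p q ^+ n * v q 0.
  by rewrite block_diag_mulE; apply: eq_bigr => q _; rewrite mxE.
split => [/matrixP h p|h]; first by rewrite -E h mxE.
by apply/matrixP => p j; rewrite ord1 E h mxE.
Qed.

Lemma block_power_sums_level_set (C : idomainType) (N : nat) (A : 'M[C]_N)
    (P : {set {set 'I_N}}) (v : 'cV[C]_N) :
  (forall n, (n < N)%N -> rker (block_diag P (hadamard_pow A n)) v) ->
  forall p c, \sum_(q in finset.pblock P p | A p q == c) v q 0 = 0.
Proof.
move=> h p c; rewrite big_mkcondl.
pose w q := if q \in finset.pblock P p then v q 0 else 0.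
apply: (@power_sums_level_set _ _ (A p) w) => n; rewrite card_ord => nN.
have /rker_block_hadamardP/(_ p) := h n nN.
rewrite big_mkcond => S0; rewrite -[RHS]S0; apply: eq_bigr => q _.
by rewrite /w; case: ifP; rewrite ?mulr0.
Qed.

(** * Comparison of the kernels *)

(** Along each block of [pi] the rows of the block-diagonal matrix are constant,
    since [pi'] is coarser than [pi]; hence they only see the block sums of [v]. *)
Lemma ker_J_sub_block (C : numClosedFieldType) (N : nat) (A : 'M[C]_N)
    (pi pi' : {set {set 'I_N}}) (v : 'cV[C]_N) :
  A \is hermsymmx -> is_isogenic_partition A pi ->
  finset.partition pi' [set: 'I_N] -> refines pi pi' ->
  ker_J C pi v -> forall n, rker (block_diag pi' (hadamard_pow A n)) v.
Proof.
move=> hA iso ppi' ref /ker_JP h n; have ppi := iso.1.1.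
apply/rker_block_hadamardP => p; rewrite big_mkcond.
pose f q := if q \in finset.pblock pi' p then A p q ^+ n else 0.
rewrite (eq_bigr (fun q => f q * v q 0)); last first.
  by move=> q _; rewrite /f; case: ifP; rewrite ?mul0r.
apply: (sum_block_const ppi) => // q r rq; rewrite /f.
rewrite (refines_pblock ppi ppi' ref p rq).
have /(isogenic_pblockP hA iso) rows := rq.
by rewrite [A p r](hermsymmx_conj hA) -rows -(hermsymmx_conj hA).
Qed.

(** The inclusion that needs positivity. Fix [p] and split the level set
    [T = {q in its pi'-block | A p q = A p p}], over which [v] sums to zero. It is
    saturated for [pi], it contains the [pi]-block of [p], and every other [q] in
    it satisfies [A p p < A q q]. By induction on the number of diagonal entries
    exceeding [A p p], the block sums at those [q] vanish, so that only the sum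
    over the block of [p] remains. *)
Lemma block_sub_ker_J (C : numClosedFieldType) (N : nat) (A : 'M[C]_N)
    (pi pi' : {set {set 'I_N}}) (v : 'cV[C]_N) :
  three_PMP A -> is_isogenic_partition A pi ->
  finset.partition pi' [set: 'I_N] -> refines pi pi' ->
  (forall n, (n < N)%N -> rker (block_diag pi' (hadamard_pow A n)) v) ->
  ker_J C pi v.
Proof.
move=> hA iso ppi' ref /block_power_sums_level_set h; have ppi := iso.1.1.
have hermA := hermsymmx_conj hA.1; have blockP := isogenic_pblockP hA.1 iso.
have reff := refines_pblock ppi ppi' ref.
have /and3P[/eqP cpi' _ _] := ppi'.
apply/ker_JP => p.
have [m] := ubnP #|[set q | A p p < A q q]%SET|.
elim: m p => // m IH p ltm.
pose T q := (q \in finset.pblock pi' p) && (A p q == A p p).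
have colE q r : r \in finset.pblock pi q -> A p r = A p q.
  by move=> /blockP rows; rewrite hermA -rows -hermA.
have Tstable q r : r \in finset.pblock pi q -> T r = T q.
  by move=> rq; rewrite /T (reff p _ _ rq) (colE _ _ rq).
have pT q : q \in finset.pblock pi p -> T q.
  move=> qp; rewrite (Tstable _ _ qp) /T eqxx andbT.
  by rewrite mem_pblock cpi' inE.
have := h p (A p p); rewrite (bigID (mem (finset.pblock pi p)))/=.
rewrite [X in X + _](eq_bigl (mem (finset.pblock pi p))); last first.
  by move=> q /=; rewrite andb_idl// => /pT.
rewrite [X in _ + X](_ : _ = 0) ?addr0//.
(* the rest of [T], a union of blocks already treated *)
pose f q : C := (T q && (q \notin finset.pblock pi p))%:R.
rewrite big_mkcond (eq_bigr (fun q => f q * v q 0)); last first.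
  by move=> q _; rewrite /f -/(T q); case: ifP; rewrite ?mul0r ?mul1r.
apply: (sum_block_const ppi) => [q r rq|q].
  rewrite /f (Tstable _ _ rq); congr (_ && ~~ _)%:R.
  have rP : refines pi pi by move=> B Bpi; exists B.
  exact: (refines_pblock ppi ppi rP).
rewrite /f; case: andP; rewrite ?eqxx// => -[/andP[qp' /eqP eq_pq] npq] _.
have ltpq : A p p < A q q.
  rewrite lt_neqAle three_PMP_diag_le// andbT; apply: contraNneq npq => e.
  by apply/blockP; apply: three_PMP_diag_eq_rows.
apply: IH; apply: leq_trans (ltnSE ltm); apply: proper_card.
apply/properP; split.
  by apply/fintype.subsetP => r; rewrite !inE; exact: lt_trans.
by exists q; rewrite !inE ?ltxx.
Qed.

Lemma partition_setT (T : finType) (x : T) :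
  finset.partition [set [set: T]]%SET [set: T].
Proof.
rewrite /finset.partition /finset.trivIset /finset.cover !big_set1 !eqxx /=.
rewrite finset.in_set1 eq_sym; apply/finset.set0Pn; exists x.
by rewrite inE.
Qed.

(** Through the one-block partition, full Hadamard powers become an instance of
    block-diagonal ones. *)
Lemma block_diag_setT (C : nzRingType) (N : nat) (A : 'M[C]_N) :
  block_diag [set [set: 'I_N]]%SET A = A.
Proof.
apply/matrixP => p q; rewrite mxE.
have /and3P[_ tT _] := partition_setT p.
by rewrite (def_pblock tT (finset.set11 _)) inE.
Qed.

Lemma three_PMP_kernels_agree (C : numClosedFieldType) (N : nat) (A : 'M[C]_N)
    (pi pi' : {set {set 'I_N}}) :
  (0 < N)%N -> three_PMP A -> is_isogenic_partition A pi ->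
  finset.partition pi' [set: 'I_N] -> refines pi pi' -> kernels_agree A pi pi'.
Proof.
move=> N0 hA iso ppi' ref.
have pT := partition_setT (Ordinal N0).
have rT : refines pi [set [set: 'I_N]]%SET.
  by move=> B _; exists [set: 'I_N]%SET; rewrite ?inE ?finset.subsetT.
have EJ : ker_block_powers A pi' = ker_J C pi.
  apply/seteqP; split => v h; last first.
    by move=> n _; exact: (ker_J_sub_block hA.1 iso ppi' ref).
  by apply: (block_sub_ker_J hA iso ppi' ref) => n _; apply: h.
have fJ v : ker_first_powers A v -> ker_J C pi v.
  move=> h; apply: (block_sub_ker_J hA iso pT rT) => n nN.
  by rewrite block_diag_setT; apply: h.
have Ja v : ker_J C pi v -> ker_all_powers A v.
  move=> h n _; rewrite -[hadamard_pow A n]block_diag_setT.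
  exact: (ker_J_sub_block hA.1 iso pT rT).
split; last exact: EJ.
  apply/seteqP; split => v h; first exact/Ja/fJ.
  by move=> n _; apply: h.
by rewrite EJ; apply/seteqP; split => v h; [apply: fJ => n _; apply: h|exact: Ja].
Qed.

(** * Failure of the equalities without positivity *)

(** The symmetric matrix with rows [1 1 0 0], [1 0 0 1], [0 0 1 1], [0 1 1 0]. *)
Definition anticirculant_mx (C : nzRingType) : 'M[C]_4 :=
  \matrix_(i < 4, j < 4) ((i + j) %% 4 < 2)%N%:R.

Lemma anticirculant_mx_herm (C : numClosedFieldType) :
  anticirculant_mx C \is hermsymmx.
Proof.
apply/is_hermitianmxP/matrixP => i j.
by rewrite !mxE expr0 mul1r addnC conjC_nat.
Qed.

(** Each row has its two ones, and its two zeros, in columns of opposite parity,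
    so the alternating vector is annihilated by all Hadamard powers. The rows are
    pairwise distinct, so that the blocks of [pi] are singletons and [ker_J] is
    zero. *)
Lemma anticirculant_mx_kernels (C : numClosedFieldType)
    (pi pi' : {set {set 'I_4}}) :
  is_isogenic_partition (anticirculant_mx C) pi ->
  ~ kernels_agree (anticirculant_mx C) pi pi'.
Proof.
move=> iso [_ E1 E2].
have blockP := isogenic_pblockP (anticirculant_mx_herm C) iso.
pose v : 'cV[C]_4 := \col_i (-1) ^+ odd i.
have vA : ker_all_powers (anticirculant_mx C) v.
  move=> n _; apply/matrixP => i j.
  rewrite !mxE !big_ord_recl big_ord0 !mxE /=.
  rewrite /bump /= !addnE /= !expr0 !expr1.
  case: n => [|n]; first by rewrite !expr0; ring.
  have X (b : bool) : b%:R ^+ n.+1 = b%:R :> C.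
    by case: b; rewrite ?expr1n ?expr0n.
  by rewrite !X; case: i => [[|[|[|[|i]]]] ii] //=; ring.
have : ker_J C pi v by rewrite -E2 -E1.
move=> /ker_JP/(_ 0).
rewrite (big_pred1 0) => [|q].
  by rewrite mxE expr0 => /eqP; rewrite oner_eq0.
rewrite /=; apply/blockP/eqP => [h|-> //].
(* rows 1, 2 and 3 differ from row 0 in column 1, 0 and 0 respectively *)
have := (h 0, h 1); rewrite !mxE.
by case: q {h} => [[|[|[|[|i]]]] ii] //= [] /eqP h0 /eqP h1;
  move: h0 h1; rewrite ?oner_eq0// => _ _; apply: val_inj.
Qed.

Theorem theorem5p1 (R : realType) :
  (forall (N : nat) (A : 'M[R[i]]_N) (pi pi' : {set {set 'I_N}}),
     (0 < N)%N ->
     three_PMP A ->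
     is_isogenic_partition A pi ->
     finset.partition pi' [set: 'I_N] ->
     refines pi pi' ->
     kernels_agree A pi pi')
  /\
  (exists (N : nat) (A : 'M[R[i]]_N) (pi : {set {set 'I_N}}),
     [/\ (0 < N)%N,
         A \is hermsymmx,
         ~ three_PMP A,
         is_isogenic_partition A pi &
         forall pi' : {set {set 'I_N}},
           finset.partition pi' [set: 'I_N] ->
           refines pi pi' ->
           ~ kernels_agree A pi pi']).
Proof.
split=> [N A pi pi'|]; first exact: three_PMP_kernels_agree.
have [pi iso] := isogenic_partition_exists (anticirculant_mx R[i]).
exists 4%N, (anticirculant_mx R[i]), pi; split => //.
- exact: anticirculant_mx_herm.
- move=> hA; apply: (anticirculant_mx_kernels (pi' := pi) iso).
  by apply: three_PMP_kernels_agree => //; [exact: iso.1.1|move=> B; exists B].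
- by move=> pi' _ _; exact: anticirculant_mx_kernels.
Qed.
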